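(* For every constant $s>0$ there is a constant $d$ (depending only on $s$) such that the following holds. Let $G$ be a graph on $n\ge2$ vertices admitting an ordering $v_1,\dots,v_n$ of its vertices such that $|N(v_i)\cap\{v_{i+1},\dots,v_n\}|\le n^{s/\sqrt{\log n}}$ for every $i\in\{1,\dots,n-1\}$. Then $G$ admits a CS-Separator of size at most $n^{d}$ (i.e. of size $n^{\mathcal{O}(1)}$).
   Context: A cut of $G$ is a partition $(W,W')$ of $V(G)$; it separates disjoint $K,S$ if $K\subseteq W$ and $S\subseteq W'$. A CS-Separator of $G$ is a family of cuts such that for every clique $K$ and stable set $S$ with $K\cap S=\emptyset$ some cut separates $K$ and $S$; its size is the number of cuts. $N(v)$ denotes the neighborhood of $v$. *)

(* Defs.v *)
From mathcomp Require Import all_boot all_order all_algebra.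
From mathcomp Require Import reals exp.
Set Implicit Arguments.
Unset Strict Implicit.
Unset Printing Implicit Defensive.

Section CSSeparator.
Variables (T : finType) (e : rel T).

Definition neighborhood (v : T) : {set T} := [set w | e v w].

Definition clique (K : {set T}) : bool :=
  [forall x in K, forall y in K, (x != y) ==> e x y].

Definition stable_set (S : {set T}) : bool :=
  [forall x in S, forall y in S, ~~ e x y].

(* The two sides of a cut are ordered, and either may be empty. *)
Definition is_cut (C : {set T} * {set T}) : bool :=
  (C.1 :|: C.2 == [set: T]) && [disjoint C.1 & C.2].

Definition separates (C : {set T} * {set T}) (K S : {set T}) : bool :=
  (K \subset C.1) && (S \subset C.2).

Definition CS_separator (F : {set {set T} * {set T}}) : Prop :=
  (forall C, C \in F -> is_cut C) /\
  (forall K S : {set T}, clique K -> stable_set S -> [disjoint K & S] ->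
     exists2 C, C \in F & separates C K S).

End CSSeparator.

Definition later_vertices (T : finType) (n : nat) (v : 'I_n -> T) (i : 'I_n) :
  {set T} := [set v j | j : 'I_n & i < j].

(* Main.v *)
(** A nonempty clique [K] lies in the closed forward neighbourhood of its first
    vertex, a set [U] of at most [k + 1] vertices, so it suffices to separate
    within each of the [n] such sets, for which Yannakakis' recursive separator
    of size [k ^ O(log k)] is used.  The bound on [k] says that [(log k)^2] is
    [O(log n)], so the total size is polynomial. *)
Require Import Defs.
From mathcomp Require Import all_boot all_order all_algebra.
From mathcomp Require Import reals exp.
From mathcomp Require Import sequences lra zify.
Import Order.TTheory GRing.Theory Num.Theory.
Local Open Scope ring_scope.

Lemma leq_card_bigcup (I X : finType) (J : {set I}) (F : I -> {set X}) (m : nat) :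
  (forall i, i \in J -> (#|F i| <= m)%N) ->
  (#|\bigcup_(i in J) F i| <= #|J| * m)%N.
Proof.
move=> leFm; rewrite -sum_nat_const.
apply: (@leq_trans (\sum_(i in J) #|F i|)%N); last exact: leq_sum.
elim/big_rec2: _ => [|i m' A _ leAm]; first by rewrite cards0.
by rewrite (leq_trans (leq_card_setU _ _)) // leq_add2l.
Qed.

Section Yannakakis.
Context {T : finType} (e : rel T).

(* Clique sides of cuts separating within [U], provided [#|U| < 2 ^ t].  If the
   clique contains a vertex [v] with fewer than [2 ^ t.-1] neighbours in [U],
   recurse on these neighbours; if the stable set contains a vertex [v] with at
   least that many, recurse on the non-neighbours of [v]; otherwise the vertices
   of large degree form a suitable side. *)
Fixpoint clique_sides (t : nat) (U : {set T}) : {set {set T}} :=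
  if t is t'.+1 then
    let low v := (#|U :&: neighborhood e v| < 2 ^ t')%N in
    [set v | ~~ low v] |:
    \bigcup_(v in U)
      if low v then
        let U' := U :&: neighborhood e v in
        [set v |: A :&: U' | A in clique_sides t' U']
      else
        let U' := (U :\: neighborhood e v) :\ v in
        [set neighborhood e v :|: A :&: U' | A in clique_sides t' U']
  else [set set0].

(** Both recursive calls are on sets of size below [2 ^ t]: a high [v] has at least [2 ^ t] of the
    fewer than [2 ^ t.+1] vertices of [U] as neighbours. As [#|U| + 1 <= 2 ^ t.+1], the count is at
    most [2 ^ (t.+1 + t * t)]. *)
Lemma leq_card_clique_sides t (U : {set T}) :
  (#|U| < 2 ^ t)%N -> (#|clique_sides t U| <= 2 ^ (t * t))%N.
Proof.
elim: t U => [|t IH] U ltU /=; first by rewrite cards1.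
rewrite (leq_trans (leq_card_setU _ _)) // cards1.
apply: (@leq_trans (1 + #|U| * 2 ^ (t * t))).
  rewrite leq_add2l; apply: leq_card_bigcup => v vU.
  case: ltnP => [ltN|leN].
    exact: leq_trans (leq_imset_card _ _) (IH _ ltN).
  apply: leq_trans (leq_imset_card _ _) (IH _ _).
  apply: (@leq_ltn_trans #|U :\: neighborhood e v|).
    by rewrite subset_leq_card // subD1set.
  by have := cardsID (neighborhood e v) U; move: ltU; rewrite expnS; lia.
apply: (@leq_trans (2 ^ t.+1 * 2 ^ (t * t))).
  by have := expn_gt0 2 (t * t); nia.
by rewrite -expnD leq_exp2l //; nia.
Qed.

Lemma clique_sidesP {t} {U K S : {set T}} :
  (#|U| < 2 ^ t)%N -> clique e K -> stable_set e S -> [disjoint K & S] ->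
  exists2 A, A \in clique_sides t U &
    K :&: U \subset A /\ [disjoint S :&: U & A].
Proof.
move=> ltU /forall_inP clK /forall_inP stS dKS.
have adjK x y : x \in K -> y \in K -> x != y -> e x y.
  by move=> xK yK; have /forall_inP/(_ y yK)/implyP := clK x xK; apply.
have adjS x y : x \in S -> y \in S -> e x y = false.
  by move=> xS yS; have /forall_inP/(_ y yS)/negbTE := stS x xS.
elim: t U ltU => [|t IH] U ltU /=.
  have /eqP -> : U == set0 by rewrite -cards_eq0; move: ltU; rewrite ltnS leqn0.
  by exists set0; rewrite ?set11 // !setI0 sub0set disjoints_subset sub0set.
pose low v := (#|U :&: neighborhood e v| < 2 ^ t)%N.
have [[v /setIP [vK vU] lowv]|noK] :=
    altP (@exists_inP _ (mem (K :&: U)) low).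
  have [A AF [subA disA]] := IH _ lowv.
  (* The rest of [K :&: U] lies in the neighbourhood of [v]. [A] is controlled only inside the
     smaller set, hence the intersection. *)
  exists (v |: A :&: (U :&: neighborhood e v)).
    apply/setUP; right; apply/bigcupP; exists v => //.
    by rewrite -/(low v) lowv; apply: imset_f.
  split.
    apply/subsetP => x /setIP [xK xU]; rewrite !inE xU.
    have [//|nxv] := eqVneq x v.
    have vx : e v x by apply: adjK; rewrite // eq_sym.
    by rewrite vx (subsetP subA) // !inE xK xU vx.
  apply/pred0P => x /=; rewrite !inE; apply/negP => /andP [/andP [xS xU]].
  case/orP => [/eqP xv|/andP [xA /andP [_ vx]]].
    by have := disjointFr dKS vK; rewrite -xv xS.
  by have := disjointFl disA xA; rewrite !inE xS xU vx.
have [[v /setIP [vS vU] highv]|noS] :=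
    altP (@exists_inP _ (mem (S :&: U)) (fun v => ~~ low v)).
  have ltU' : (#|(U :\: neighborhood e v) :\ v| < 2 ^ t)%N.
    apply: (@leq_ltn_trans #|U :\: neighborhood e v|).
      by rewrite subset_leq_card // subD1set.
    have := cardsID (neighborhood e v) U.
    by move: ltU highv; rewrite /low expnS; lia.
  have [A AF [subA disA]] := IH _ ltU'.
  (* As [v] is in [S], its whole neighbourhood avoids [S] and may join the clique side. *)
  exists (neighborhood e v :|: A :&: ((U :\: neighborhood e v) :\ v)).
    apply/setUP; right; apply/bigcupP; exists v => //.
    by rewrite -/(low v) (negbTE highv); apply: imset_f.
  split.
    apply/subsetP => x /setIP [xK xU]; rewrite !inE xU.
    have nxv : x != v.
      by apply: contraTneq vS => <-; rewrite (disjointFr dKS xK).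
    case vx: (e v x) => //=; rewrite nxv andbT.
    by rewrite (subsetP subA) // !inE xK xU vx nxv.
  apply/pred0P => x /=; rewrite !inE; apply/negP => /andP [/andP [xS xU]].
  rewrite (adjS v x vS xS) => /andP [xA /andP [nxv _]].
  by have := disjointFl disA xA; rewrite !inE xS xU (adjS v x vS xS) nxv.
(* Now every vertex of [K :&: U] is high and every vertex of [S :&: U] is low. *)
exists [set v | ~~ low v]; first by rewrite setU11.
split.
  apply/subsetP => x xKU; rewrite inE; apply: contra noK => lowx.
  by apply/exists_inP; exists x.
apply/pred0P => x /=; apply/negP => /andP [xSU]; rewrite inE => highx.
by case/negP: noS; apply/exists_inP; exists x.
Qed.

End Yannakakis.

Lemma CS_separator_of_ordering {T : finType} {e : rel T} {n : nat}
    {v : 'I_n -> T} {t : nat} :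
  (0 < n)%N -> bijective v ->
  (forall i, (#|neighborhood e (v i) :&: later_vertices v i|.+1 < 2 ^ t)%N) ->
  exists F, CS_separator e F /\ (#|F| <= n * 2 ^ (t * t))%N.
Proof.
move=> n_gt0 [w vK wK] ltN.
pose U i := v i |: neighborhood e (v i) :&: later_vertices v i.
have ltU i : (#|U i| < 2 ^ t)%N.
  by apply: leq_ltn_trans (ltN i); rewrite cardsU1; case: (_ \notin _).
(* Everything outside [U i] goes to the stable side, which is harmless when [K] lies in [U i]. *)
pose cut i A : {set T} * {set T} := (A :&: U i, ~: (A :&: U i)).
exists (\bigcup_(i in [set: 'I_n]) [set cut i A | A in clique_sides e t (U i)]).
split; last first.
  have cardI : #|[set: 'I_n]| = n by rewrite cardsT card_ord.
  rewrite -[X in (_ <= X * _)%N]cardI; apply: leq_card_bigcup => i _.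
  apply: leq_trans (leq_imset_card _ _) _.
  exact: leq_card_clique_sides.
split=> [C /bigcupP [i _ /imsetP [A _ ->]]|K S clK stS dKS].
  by rewrite /is_cut /= setUCr eqxx disjoints_subset setCK subxx.
have [i subKU] : exists i, K \subset U i.
  (* The empty clique has no first vertex; any index serves. *)
  have [->|[x xK]] := set_0Vmem K; first by exists (Ordinal n_gt0); apply: sub0set.
  have vwK : v (w x) \in K by rewrite wK.
  case: (arg_minnP (P := fun i => v i \in K) (fun i : 'I_n => i : nat) vwK).
  move=> i viK min_i; exists i; apply/subsetP => y yK; rewrite !inE.
  have [//|nyv] := eqVneq y (v i).
  have /forall_inP/(_ _ yK)/implyP := forall_inP clK _ viK.
  rewrite eq_sym nyv => -> //=; apply/imsetP; exists (w y); rewrite ?wK //.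
  rewrite inE ltn_neqAle min_i ?wK // andbT.
  by apply: contra nyv => /eqP/val_inj ->; rewrite wK.
have [A AF [subA disA]] := clique_sidesP e (ltU i) clK stS dKS.
exists (cut i A); first by apply/bigcupP; exists i; rewrite ?imset_f.
rewrite /separates /= subsetI subKU andbT.
rewrite (setIidPl subKU) in subA; rewrite subA /=.
apply/subsetP => x xS; rewrite inE; apply/negP => /setIP [xA xU].
by have := disjointFl disA xA; rewrite inE xS xU.
Qed.

Theorem theorem4 (R : realType) (s : R) (hs : 0 < s) :
  exists d : R,
    forall (n : nat) (T : finType) (e : rel T) (v : 'I_n -> T),
      (2 <= n)%N -> #|T| = n ->
      symmetric e -> irreflexive e ->
      bijective v ->
      (forall i : 'I_n, (i.+1 < n)%N ->
         #|neighborhood e (v i) :&: later_vertices v i|%:R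
           <= n%:R `^ (s / Num.sqrt (ln n%:R)) :> R) ->
      exists F : {set {set T} * {set T}},
        CS_separator e F /\ #|F|%:R <= n%:R `^ d :> R.
Proof.
pose c : R := ln 2.
have c_gt0 : 0 < c by rewrite ln_gt0 // ltr1n.
(* One unit of the exponent pays for the factor [n]; the remaining [8 + 2 * s ^+ 2 / c] pays for
   [2 ^ (t * t)]. *)
exists (9 + 2 * s ^+ 2 / c) => n T e v n_ge2 _ _ _ bij_v leN.
pose L : R := ln n%:R.
have n_gt0 : 0 < n%:R :> R by rewrite ltr0n; lia.
have leCL : c <= L by rewrite ler_ln ?posrE // ler_nat.
pose x := s * Num.sqrt L.
have x_ge0 : 0 <= x by rewrite mulr_ge0 ?sqrtr_ge0 // ltW.
have x2 : x ^+ 2 = s ^+ 2 * L by rewrite exprMn sqr_sqrtr //; lra.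
have powE : n%:R `^ (s / Num.sqrt L) = expR x :> R.
  rewrite /powR gt_eqF // -/L; congr (expR _); rewrite /x.
  have L_gt0 : 0 < L by lra.
  rewrite -{2}(sqr_sqrtr (ltW L_gt0)) expr2 mulrA divfK //.
  by rewrite gt_eqF // sqrtr_gt0.
have k_ge1 : 1 <= expR x by rewrite -expR0 ler_expR.
pose m := Num.truncn (1 + expR x).
have m_gt0 : (0 < m)%N by rewrite truncn_gt0; lra.
pose t := (trunc_log 2 m).+1.
have ltN i : (#|neighborhood e (v i) :&: later_vertices v i|.+1 < 2 ^ t)%N.
  apply: leq_ltn_trans (trunc_log_ltn m (isT : (1 < 2)%N)).
  rewrite truncn_ge_nat; last by lra.
  rewrite -natr1 addrC lerD2l.
  (* The hypothesis omits the last vertex, which has no later vertices. *)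
  have [lti|gei] := ltnP i.+1 n; first by rewrite -powE; exact: leN.
  suff -> : later_vertices v i = set0 by rewrite setI0 cards0 expR_ge0.
  apply/setP => y; rewrite !inE; apply/negP => /imsetP [j].
  by rewrite inE; have := ltn_ord j; lia.
have [F [csF leF]] := CS_separator_of_ordering (ltnW n_ge2) bij_v ltN.
exists F; split=> //.
have exp2 k : (2 ^ k)%:R = expR (k%:R * c) :> R.
  by rewrite natrX expRM_natl lnK // posrE.
have tc : t%:R * c <= 2 * c + x.
  (* [m <= 1 + expR x <= 2 * expR x], since [x] is nonnegative. *)
  have : (2 ^ trunc_log 2 m)%:R <= 2 * expR x :> R.
    apply: (@le_trans _ _ m%:R).
      by rewrite ler_nat trunc_logP.
    have := truncn_le (1 + expR x); rewrite -/m; lra.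
  rewrite exp2 -{1}(@lnK _ (2 : R)) ?posrE // -expRD ler_expR -/c.
  rewrite /t -natr1; lra.
have ttc : t%:R * t%:R * c <= (8 + 2 * s ^+ 2 / c) * L.
  rewrite -(ler_pM2r c_gt0).
  have -> : (8 + 2 * s ^+ 2 / c) * L * c = 8 * L * c + 2 * x ^+ 2.
    by rewrite x2 mulrDl mulrDl -!mulrA [L * c]mulrC mulKf ?gt_eqF //.
  have : 0 <= t%:R * c by rewrite mulr_ge0 // ltW.
  (* This square gives [(2 * c + x) ^+ 2 <= 8 * c ^+ 2 + 2 * x ^+ 2], and [c <= L] turns [c ^+ 2]
     into [L * c]. *)
  have := sqr_ge0 (2 * c - x); nra.
apply: (@le_trans _ _ (n * 2 ^ (t * t))%:R); first by rewrite ler_nat.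
rewrite natrM exp2 natrM /powR gt_eqF // -/L -{1}(@lnK _ n%:R) ?posrE //.
by rewrite -expRD ler_expR -/L; lra.
Qed.
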